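(* Let $n\ge1$ and let $\mathbf P=(\Delta_T)_{\emptyset\ne T\subseteq[n]}$, where $\Delta_T=\mathrm{conv}(\mathbf e_i\mid i\in T)\subset\mathbb{R}^n$, with variables $\mathbf x=(x_T)_{\emptyset\neq T\subseteq[n]}$. When $\langle\mathbf x,\mathbf 1\rangle=\sum_T x_T=0$, or equivalently, after substituting $x_{[n]}=-\sum_{\emptyset\ne T\subsetneq[n]}x_T$, the hyperplane dual mixed volume of the generalized permutohedron is $$\tilde m_{\mathbf P}(\mathbf x)|_{\langle\mathbf x,\mathbf 1\rangle=0}=(-1)^{n-1}\sum_{\sigma\in S_n}\ \prod_{a=1}^{n-1}\frac{1}{\displaystyle\sum_{\emptyset\ne T\subseteq\sigma[1:a]}x_T},$$ where $\sigma[1:a]=\{\sigma(1),\ldots,\sigma(a)\}$.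
   Context: The generalized permutohedron is $\mathbf x\mathbf P=\sum_{\emptyset\ne T\subseteq[n]}x_T\Delta_T$. Hyperplane dual mixed volume: let $H_t=\{\mathbf y\in\mathbb{R}^n:y_1+\cdots+y_n=t\}$ and let $\mathbf P=(P_1,\dots,P_r)$ be polytopes in $H_1$ whose Minkowski sum $P$ has dimension $n-1$. Let $\mathrm{cone}(P)=\{t\mathbf y:\mathbf y\in P,t\ge0\}$ and $\mathrm{cone}(P)^*=\{\mathbf v:\langle\mathbf v,\mathbf y\rangle\ge0\ \forall\mathbf y\in\mathrm{cone}(P)\}$. With $h_{P_i}(\mathbf v)=-\min_{\mathbf y\in P_i}\langle\mathbf v,\mathbf y\rangle$ and $\mathcal T$ a triangulation of the boundary of $\mathrm{cone}(P)^*$ into $(n-1)$-dimensional simplicial cones, $$\tilde m_{\mathbf P}(\mathbf x,\mathbf z)=\sum_{F=\mathrm{span}_{\ge0}(\mathbf v_1,\dots,\mathbf v_{n-1})\in\mathcal T}\frac{|\det(\mathbf v_1,\dots,\mathbf v_{n-1},\mathbf 1)|}{\prod_{j=1}^{n-1}\bigl(\sum_{i}x_ih_{P_i}(\mathbf v_j)+\langle\mathbf v_j,\mathbf z\rangle\bigr)},\qquad\mathbf 1=(1,\dots,1),$$ (independent of $\mathcal T$). Here $\tilde m_{\mathbf P}(\mathbf x)$ means $\tilde m_{\mathbf P}(\mathbf x,\mathbf 0)$, and $|_{\langle\mathbf x,\mathbf 1\rangle=0}$ denotes restriction of this rational function to the hyperplane where the sum of all the variables $\mathbf x$ is zero. 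*)

(* Defs.v *)
From mathcomp Require Import all_boot all_order all_algebra perm.
From mathcomp Require Import fraction mpoly.
From mathcomp Require Import boolp classical_sets reals topology normedtype.

Set Implicit Arguments.
Unset Strict Implicit.
Unset Printing Implicit Defensive.

Import Order.TTheory GRing.Theory Num.Theory.
Import numFieldNormedType.Exports.
Local Open Scope classical_set_scope.
Local Open Scope ring_scope.

Section Polyhedra.
Variables (R : realType) (n : nat).
Implicit Types (v y : 'rV[R]_n) (A C : set 'rV[R]_n).

Definition dotv v y : R := \sum_(i < n) v 0 i * y 0 i.

Definition conv A : set 'rV[R]_n :=
  [set y | exists (k : nat) (w : 'I_k -> R) (p : 'I_k -> 'rV[R]_n),
     [/\ forall j, 0 <= w j, \sum_j w j = 1, forall j, A (p j)
       & y = \sum_j w j *: p j]].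

Definition minkowski_sum (I : finType) (P : I -> set 'rV[R]_n)
    : set 'rV[R]_n :=
  [set y | exists2 p : I -> 'rV[R]_n,
     (forall i, P i (p i)) & y = \sum_i p i].

Definition cone A : set 'rV[R]_n :=
  [set x | exists t y, [/\ 0 <= t, A y & x = t *: y]].

Definition dual_cone C : set 'rV[R]_n :=
  [set v | forall y, C y -> 0 <= dotv v y].

Definition boundary A : set 'rV[R]_n := closure A `\` interior A.

Definition span_ge0 (s : seq 'rV[R]_n) : set 'rV[R]_n :=
  [set x | exists2 c : 'I_(size s) -> R,
     (forall j, 0 <= c j) & x = \sum_j c j *: s`_j].

(* [inf] is the minimum whenever [A] is compact and nonempty, in particular
   for a polytope. *)
Definition hfun A v : R := - inf [set dotv v y | y in A].

(* A triangulation of [B] into d-dimensional simplicial cones: the cells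
   [span_ge0 (V j)] are pairwise distinct, cover [B] exactly, and any two of
   them meet in a common face; the faces of a simplicial cone are the cones
   spanned by subfamilies of its generators.  Generators are recorded up to
   order and positive scaling, and rays other than the extreme rays of [B]
   are allowed. *)
Definition triangulation d (J : finType) (V : J -> d.-tuple 'rV[R]_n)
    (B : set 'rV[R]_n) : Prop :=
  [/\ forall j, free (V j),
      injective (fun j => span_ge0 (V j)),
      \bigcup_j span_ge0 (V j) = B
    & forall j k, exists s t : seq 'rV[R]_n,
        [/\ subseq s (V j), subseq t (V k),
            span_ge0 (V j) `&` span_ge0 (V k) = span_ge0 s
          & span_ge0 s = span_ge0 t]].

End Polyhedra.

Section DualMixedVolume.
Variables (R : realType) (n : nat) (I : finType).

(* The variables x_i are indexed by an arbitrary finite type [I]; [xvar] and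
   [cst] embed variables and real constants in the field R(x). *)
Definition ratfun := {fraction {mpoly R[#|I|]}}.

Definition xpoly (i : I) : {mpoly R[#|I|]} := 'X_(enum_rank i).

Definition xvar (i : I) : ratfun := FracField.tofrac (xpoly i).

Definition cst (c : R) : ratfun := FracField.tofrac c%:MP.

(* [x] and [z] range over the field R(x), so that the formula can be taken at
   the variables themselves. *)
Definition hdmv_at (P : I -> set 'rV[R]_n)
    (J : finType) (V : J -> n.-1.-tuple 'rV[R]_n)
    (x : I -> ratfun) (z : 'rV[ratfun]_n) : ratfun :=
  \sum_(j : J)
    cst `|\det (\matrix_(a < n) (rcons (V j) (const_mx 1))`_a)| /
    \prod_(v <- V j)
      (\sum_(i : I) x i * cst (hfun (P i) v) + \sum_(k < n) cst (v 0 k) * z 0 k).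

Definition hdmv (P : I -> set 'rV[R]_n)
    (J : finType) (V : J -> n.-1.-tuple 'rV[R]_n) : ratfun :=
  hdmv_at P V xvar 0.

(* [g] is the result of the polynomial substitution [s] in [f]: some
   representation of [f] has a denominator not killed by [s].  Such a [g]
   is unique. *)
Definition frac_subst (s : I -> {mpoly R[#|I|]}) (f g : ratfun) : Prop :=
  let sub p := p \mPo [tuple s (enum_val k) | k < #|I|] in
  exists p q : {mpoly R[#|I|]},
    [/\ sub q != 0,
        f = FracField.tofrac p / FracField.tofrac q
      & g = FracField.tofrac (sub p) / FracField.tofrac (sub q)].

End DualMixedVolume.

Section Permutohedron.
Variables (R : realType) (n : nat).

Definition nonempty_subset : finType := {T : {set 'I_n} | T != finset.set0}.

(* Coordinates are indexed by 'I_n = {0, ..., n-1} instead of [n]. *)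
Definition Delta (T : nonempty_subset) : set 'rV[R]_n :=
  conv [set (delta_mx 0 i : 'rV[R]_n) | i in [set i | i \in val T]].

(* x_[n] := - sum of the other variables, the rest unchanged: restriction to
   the hyperplane where the variables sum to 0. *)
Definition sum0_subst (T : nonempty_subset) : {mpoly R[#|nonempty_subset|]} :=
  if val T == [set: 'I_n]%SET
  then - \sum_(U : nonempty_subset | val U != [set: 'I_n]%SET) xpoly R U
  else xpoly R T.

(* sigma[1:a], the first [a] values of sigma. *)
Definition initial_image (sigma : 'S_n) (a : nat) : {set 'I_n} :=
  (sigma @: [set i : 'I_n | (i < a)%N])%SET.

End Permutohedron.

(* Main.v *)
Require Import Defs.
From mathcomp Require Import all_boot all_order all_algebra perm.
From mathcomp Require Import fraction mpoly.
From mathcomp Require Import boolp classical_sets reals topology normedtype.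
From mathcomp Require Import ring lra.

Set Implicit Arguments.
Unset Strict Implicit.
Unset Printing Implicit Defensive.

Import Order.TTheory GRing.Theory Num.Theory.
Import numFieldNormedType.Exports.
Local Open Scope ring_scope.

(** Let [phi v = \sum_T \min_(i in T) v_i].  The dual cone is [phi >= 0] and its
    boundary is [phi = 0].  Since [phi] is superadditive, every cell of a
    triangulation of the boundary lies in a single chamber of the braid
    arrangement, on which [phi] and all the [h_T] are linear.  The part of the
    boundary in the chamber of [sigma] is the simplicial cone on the vectors
    [1_S - c_S 1] with [phi (1_S - c_S 1) = 0], [S = sigma[1:a]], [0 < a < n]; its
    generators and [1] have determinant [+-1], and when [\sum_T x_T = 0] the
    linear form takes the value [- \sum_(T \subset S) x_T] on them.

    It remains to see that [|det V| / \prod_v ell v] is additive on the cells in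
    one chamber, i.e. that a linear relation, valid at generic points, between
    the indicators of simplicial cones yields the same relation between these
    quantities.  This goes by induction on the dimension.  For a generic [w],
    expanding [w] in the generators of a cone gives
    [ell w * |det V| / \prod_v ell v = \sum_v +- |det (w, V \ v)| / \prod_(u != v) ell u].
    Group the walls [V \ v] by the hyperplane [H] that they span: comparing the
    given relation at [p + t w] and [p - t w] for [p] generic in [H] and small
    [t > 0] produces a relation between the indicators of the walls in [H]. *)

(** * Generic points and coordinates in simplicial cones *)

Section SmallParameter.
Variable R : realFieldType.

Definition small (P : R -> Prop) :=
  exists2 e, 0 < e & forall t, 0 < t < e -> P t.

Lemma small_ex P : small P -> exists2 t, 0 < t & P t.
Proof.
by case=> e e0 Pe; exists (e / 2); [lra | apply: Pe; apply/andP; split; lra].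
Qed.

Lemma small_mono (P Q : R -> Prop) :
  (forall t, 0 < t -> P t -> Q t) -> small P -> small Q.
Proof.
move=> PQ [e e0 Pe]; exists e => // t te.
by apply: PQ (Pe _ te); case/andP: te.
Qed.

Lemma small_and (P Q : R -> Prop) :
  small P -> small Q -> small (fun t => P t /\ Q t).
Proof.
move=> [e e0 Pe] [f f0 Qf]; exists (Num.min e f); first by rewrite lt_min e0.
move=> t; rewrite lt_min => /and3P[t0 te tf].
by split; [apply: Pe | apply: Qf]; rewrite t0.
Qed.

Lemma small_all (T : eqType) (s : seq T) (P : T -> R -> Prop) :
  (forall x, x \in s -> small (P x)) ->
  small (fun t => forall x, x \in s -> P x t).
Proof.
elim: s => [|x s IHs] Ps; first by exists 1.
have [||e e0 Pe] := small_and (Ps x _) (IHs _); first exact: mem_head.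
  by move=> y ys; apply: Ps; rewrite inE ys orbT.
exists e => // t te y; have [Px Psub] := Pe t te.
by rewrite inE => /predU1P[->|/Psub].
Qed.

Lemma small_sign (a b : R) : a != 0 -> small (fun t => (0 <= a + t * b) = (0 <= a)).
Proof.
move=> a0; exists (`|a| / (`|b| + 1)).
  by rewrite divr_gt0 ?normr_gt0 // ltr_pwDr.
move=> t /andP[t0]; rewrite ltr_pdivlMr ?ltr_pwDr // mulrDr mulr1 => tb.
have : `|t * b| < `|a| by rewrite normrM (gtr0_norm t0); lra.
rewrite ltr_norml => /andP[tb1 tb2].
case: (ltrgt0P a) a0 tb1 tb2 => // a0 _ tb1 tb2; first by apply/idP; lra.
by apply/negbTE; rewrite -ltNge; lra.
Qed.

End SmallParameter.

Section Generic.
Variables (R : realFieldType) (E : vectType R).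
Implicit Types (W H : {vspace E}) (U : set E) (p q w : E).

(** A predicate instead of a [{vspace E}], so that the zero set of the [K]-valued form [ell] and the
    locus where two coordinates agree qualify directly. *)
Definition lincl U := forall (a : R) u v, U u -> U v -> U (a *: u + v).

Lemma lincl_vspace H : lincl (fun p => p \in H).
Proof. by move=> a u v uH vH; rewrite rpredD ?rpredZ. Qed.

(** Two points of [U] on the ray [p + t *: q], at parameters t < e, would put [q], and then [p], in
    [U]. So a parameter [e] at which the ray meets [U], if there is one, bounds an interval free of
    [U]. *)
Lemma small_notin U p q : lincl U -> ~ U p \/ ~ U q ->
  small (fun t => ~ U (p + t *: q)).
Proof.
move=> lU; have Z a u : U u -> U (a *: u).
  by move=> Uu; have := lU (a - 1) u u Uu Uu; rewrite scalerBl scale1r subrK.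
case: (pselect (exists2 t, 0 < t & U (p + t *: q))) => [[e e0 Ue]|nU] pq; last first.
  by exists 1 => // t /andP[t0 _] Ut; apply: nU; exists t.
exists e => // t /andP[t0 te] Ut.
have Uq : U q.
  have := Z (e - t)^-1 _ (lU (-1) _ _ Ut Ue).
  rewrite scaleN1r opprD addrACA addNr add0r addrC -scalerBl scalerA mulVf ?scale1r //.
  by apply/eqP; lra.
by case: pq => // -[]; have := lU (- t) _ _ Uq Ut; rewrite scaleNr addrC addrK.
Qed.

(** Genericity means avoiding finitely many proper subspaces of [W], so that finitely many generic
    conditions hold together, and hold somewhere by [generic_ex]. *)
Definition generically W (P : E -> Prop) :=
  exists L : seq (set E),
    (forall U, U \in L -> lincl U /\ exists2 q, q \in W & ~ U q) /\
    (forall p, p \in W -> (forall U, U \in L -> ~ U p) -> P p).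

(** The subspaces are avoided one at a time: from a point [p] off those of [L], a small step along
    some [q] outside [U] leaves [U] without entering the others. *)
Lemma generic_ex W P : generically W P -> exists2 p, p \in W & P p.
Proof.
case=> L [LW LP]; suff [p pW pL] : exists2 p, p \in W & forall U, U \in L -> ~ U p.
  by exists p => //; apply: LP.
elim: L {LP} LW => [|U L IHL] LW; first by exists 0; rewrite ?mem0v.
have [|p pW pL] := IHL; first by move=> U' U'L; apply: LW; rewrite inE U'L orbT.
have [lU [q qW Uq]] := LW U (mem_head _ _).
have [|t _ pt] := @small_ex _ (fun t => forall U', U' \in U :: L -> ~ U' (p + t *: q)).
  apply: small_all => U' U'L; apply: small_notin; first by case: (LW U' U'L).
  by move: U'L; rewrite inE => /predU1P[->|/pL]; [right | left].
by exists (p + t *: q) => //; rewrite rpredD ?rpredZ.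
Qed.

Lemma generic_mono W (P Q : E -> Prop) :
  (forall p, p \in W -> P p -> Q p) -> generically W P -> generically W Q.
Proof. by move=> PQ [L [LW LP]]; exists L; split=> // p pW /LP Pp; apply: PQ (Pp _). Qed.

Lemma generic_true W (P : E -> Prop) : (forall p, p \in W -> P p) -> generically W P.
Proof. by move=> PW; exists [::]; split=> // p /PW. Qed.

Lemma generic_and W (P Q : E -> Prop) :
  generically W P -> generically W Q -> generically W (fun p => P p /\ Q p).
Proof.
move=> [L [LW LP]] [M [MW MQ]]; exists (L ++ M); split.
  by move=> U; rewrite mem_cat => /orP[/LW|/MW].
move=> p pW LMp; split; [apply: LP => // | apply: MQ => //] => U UL;
  by apply: LMp; rewrite mem_cat UL ?orbT.
Qed.

Lemma generic_all W (T : eqType) (s : seq T) (P : T -> E -> Prop) :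
  (forall x, x \in s -> generically W (P x)) ->
  generically W (fun p => forall x, x \in s -> P x p).
Proof.
elim: s => [|x s IHs] Ps; first exact: generic_true.
have Px := Ps x (mem_head _ _).
have {}IHs : generically W (fun p => forall x, x \in s -> P x p).
  by apply: IHs => y ys; apply: Ps; rewrite inE ys orbT.
apply: generic_mono (generic_and Px IHs) => p _ [Pxp Pp] y.
by rewrite inE => /predU1P[->|/Pp].
Qed.

Lemma generic_notin W U q : lincl U -> q \in W -> ~ U q -> generically W (fun p => ~ U p).
Proof.
move=> lU qW Uq; exists [:: U]; split; last by move=> p _; apply; rewrite mem_head.
by move=> U'; rewrite inE => /eqP->; split=> //; exists q.
Qed.

Lemma generic_notinv W H : ~~ (W <= H)%VS -> generically W (fun p => p \notin H).
Proof.
case/subvPn => q qW qH.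
apply: generic_mono (generic_notin (@lincl_vspace H) qW _); last exact/negP.
by move=> p _ /negP.
Qed.

End Generic.

Section Coordinates.
Variables (R : realFieldType) (E : vectType R).
Implicit Types (s : seq E) (p q v w : E).

(** Coordinates are indexed by the vectors of [s] and not by their positions, so that they can be
    compared between [s] and [rem v s]. In a free family the sum has at most one term. *)
Definition cf s p v : R := \sum_(i < size s | s`_i == v) coord (in_tuple s) i p.

Lemma cfDZ s p t q v : cf s (p + t *: q) v = cf s p v + t * cf s q v.
Proof.
by rewrite /cf mulr_sumr -big_split; apply: eq_bigr => i _; rewrite linearD linearZ.
Qed.

Lemma cf_nth s p (i : 'I_(size s)) : uniq s -> cf s p s`_i = coord (in_tuple s) i p.
Proof. by move=> us; rewrite /cf (big_pred1 i) // => k /=; rewrite nth_uniq. Qed.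

Lemma cf_sum s p : free s -> p \in <<s>>%VS -> p = \sum_(v <- s) cf s p v *: v.
Proof.
move=> fs ps; rewrite {1}(@coord_span _ _ _ (in_tuple s) p ps) (big_nth 0) big_mkord.
by apply: eq_bigr => i _; rewrite cf_nth ?free_uniq.
Qed.

Lemma cf_uniq s (c : E -> R) v : free s -> v \in s ->
  cf s (\sum_(u <- s) c u *: u) v = c v.
Proof.
move=> fs /(nthP 0)[i lt_i <-].
rewrite (cf_nth _ (Ordinal lt_i)) ?free_uniq // (big_nth 0) big_mkord.
by rewrite (coord_sum_free (X := in_tuple s) (fun i => c s`_i)).
Qed.

Lemma free_rem s v : free s -> v \in s -> free (rem v s) /\ v \notin <<rem v s>>%VS.
Proof. by move=> fs /perm_to_rem/perm_free; rewrite fs free_cons => /esym/andP[]. Qed.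

Lemma rem_neq s v u : free s -> u \in rem v s -> u != v.
Proof. by move=> fs; apply: contraTneq => ->; rewrite mem_rem_uniqF ?free_uniq. Qed.

Lemma dim_rem s v : free s -> v \in s -> \dim <<rem v s>> = (\dim <<s>>).-1.
Proof.
move=> fs vs; have [fr _] := free_rem fs vs.
by rewrite (eqnP fr) (eqnP fs) size_rem.
Qed.

Lemma cf_rem s v p u : free s -> v \in s -> p \in <<rem v s>>%VS -> u \in s ->
  cf s p u = if u == v then 0 else cf (rem v s) p u.
Proof.
move=> fs vs pr us; have [fr _] := free_rem fs vs.
set c := fun u => if u == v then 0 else cf (rem v s) p u.
rewrite -/(c u) -(cf_uniq c fs us); congr cf.
rewrite (perm_big _ (perm_to_rem vs)) /= big_cons {1}/c eqxx scale0r add0r.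
rewrite {1}(cf_sum fr pr); apply: eq_big_seq => x xr.
by rewrite /c (negbTE (rem_neq fs xr)).
Qed.

Lemma cf_eq0 s v p : free s -> v \in s -> p \in <<s>>%VS ->
  (cf s p v == 0) = (p \in <<rem v s>>%VS).
Proof.
move=> fs vs ps; apply/eqP/idP => [c0|pr]; last by rewrite (cf_rem fs vs pr vs) eqxx.
rewrite (cf_sum fs ps) (perm_big _ (perm_to_rem vs)) /= big_cons c0 scale0r add0r.
by rewrite big_seq; apply: rpred_sum => u ur; rewrite rpredZ ?memv_span.
Qed.

Lemma cf_sub s v p : free s -> v \in s -> p \in <<s>>%VS ->
  p - cf s p v *: v \in <<rem v s>>%VS.
Proof.
move=> fs vs ps; rewrite {1}(cf_sum fs ps) (perm_big _ (perm_to_rem vs)) /= big_cons addrAC subrr add0r.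
by rewrite big_seq; apply: rpred_sum => u ur; rewrite rpredZ ?memv_span.
Qed.

(** This describes the cone on [s] for [p] in the span of a free [s], the situation of
    [span_ge0P]. *)
Definition incone s p : bool := all (fun v => 0 <= cf s p v) s.

(** Off the walls no coefficient vanishes, so a small perturbation changes no sign. *)
Lemma incone_near s w p : free s -> p \in <<s>>%VS ->
  (forall v, v \in s -> p \notin <<rem v s>>%VS) ->
  small (fun t => incone s (p + t *: w) = incone s p).
Proof.
move=> fs ps pr.
have /small_all : forall v, v \in s -> small (fun t => (0 <= cf s p v + t * cf s w v) = (0 <= cf s p v)).
  by move=> v vs; apply: small_sign; rewrite cf_eq0 // pr.
apply: small_mono => t _ st; apply: eq_in_all => v vs.
by rewrite cfDZ st.
Qed.

(** At [p + t *: w] the coefficient of [v] is [t * cf s w v], while the other coefficients are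
    nonzero at [p] and keep their signs. *)
Lemma incone_wall s v w p : free s -> v \in s -> p \in <<rem v s>>%VS -> cf s w v != 0 ->
  (forall u, u \in rem v s -> p \notin <<rem u (rem v s)>>%VS) ->
  small (fun t => incone s (p + t *: w) = (0 < cf s w v) && incone (rem v s) p).
Proof.
move=> fs vs pr wv0 pn; have [fr _] := free_rem fs vs.
have /small_all : forall u, u \in rem v s ->
    small (fun t => (0 <= cf s p u + t * cf s w u) = (0 <= cf (rem v s) p u)).
  move=> u ur; have us := mem_rem ur; have uv := rem_neq fs ur.
  rewrite -(_ : cf s p u = cf (rem v s) p u); last by rewrite (cf_rem fs vs pr us) (negbTE uv).
  by apply: small_sign; rewrite (cf_rem fs vs pr us) (negbTE uv) cf_eq0 // pn.
apply: small_mono => t t0 st; rewrite {1}/incone (perm_all _ (perm_to_rem vs)) /=.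
congr andb; last by apply: eq_in_all => u ur; rewrite cfDZ st.
by rewrite cfDZ (cf_rem fs vs pr vs) eqxx add0r pmulr_rge0 // le0r (negbTE wv0).
Qed.

(** Crossing [H] at [p] changes membership only if a wall of the cone spans [H]; the jump then tells
    whether [p] is in that wall, with a sign for the side of [w]. At most one wall spans [H],
    because every other wall contains the generator [v] opposite to it. *)
Lemma incone_jump (K : fieldType) (iota : {rmorphism R -> K}) s (H : {vspace E}) w p :
  free s -> w \in <<s>>%VS ->
  (forall v, v \in s -> w \notin <<rem v s>>%VS) ->
  p \in H -> (H <= <<s>>)%VS ->
  (forall v, v \in s -> <<rem v s>>%VS != H -> p \notin <<rem v s>>%VS) ->
  (forall v u, v \in s -> u \in rem v s -> p \notin <<rem u (rem v s)>>%VS) ->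
  small (fun t => (incone s (p + t *: w))%:R - (incone s (p + t *: - w))%:R =
    \sum_(v <- s | <<rem v s>>%VS == H)
       iota (Num.sg (cf s w v)) * (incone (rem v s) p)%:R).
Proof.
move=> fs ws wn pH Hs p1 p2; have ps : p \in <<s>>%VS by apply: (subvP Hs).
case: (pselect (exists2 v, v \in s & <<rem v s>>%VS == H)) => [[v vs /eqP vH]|nH]; last first.
  have nHs v : v \in s -> <<rem v s>>%VS != H by move=> vs; apply/negP => vH; apply: nH; exists v.
  have pn v : v \in s -> p \notin <<rem v s>>%VS by move=> vs; apply: p1 => //; apply: nHs.
  apply: small_mono (small_and (incone_near w fs ps pn) (incone_near (- w) fs ps pn)).
  move=> t _ [-> ->]; rewrite subrr big_seq_cond big_pred0 // => v.
  by apply/negbTE; rewrite negb_and; case: (boolP (v \in s)) => //= /nHs.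
have pr : p \in <<rem v s>>%VS by rewrite vH.
have wv0 : cf s w v != 0 by rewrite cf_eq0 ?wn.
have cfN : cf s (- w) v = - cf s w v.
  by rewrite /cf -sumrN; apply: eq_bigr => i _; rewrite linearN.
have [fr vr] := free_rem fs vs.
have wv0' : cf s (- w) v != 0 by rewrite cfN oppr_eq0.
apply: small_mono (small_and (incone_wall fs vs pr wv0 (fun u => @p2 v u vs))
   (incone_wall fs vs pr wv0' (fun u => @p2 v u vs))).
move=> t _ [-> ->]; rewrite (perm_big _ (perm_to_rem vs)) /= big_cons vH eqxx.
rewrite big_seq_cond big_pred0 ?addr0 => [|u]; last first.
  apply/negbTE; rewrite negb_and; case: (boolP (u \in rem v s)) => //= ur.
  apply: contraNneq vr => uH; rewrite vH -uH memv_span //.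
  by rewrite (rem_filter u) ?free_uniq // mem_filter /= vs andbT eq_sym (rem_neq fs ur).
rewrite cfN oppr_gt0; case: (ltrgt0P (cf s w v)) wv0 => // w0 _ /=.
  by rewrite gtr0_sg // rmorph1 mul1r subr0.
by rewrite ltr0_sg // rmorphN1 mulN1r sub0r.
Qed.

End Coordinates.

(** * Linear relations between simplicial cones *)

Section ConeValuation.
Variables (R : realFieldType) (E : vectType R) (K : fieldType).
Variables (iota : {rmorphism R -> K}) (ell : E -> K).
Hypothesis ell_lin : forall a u v, ell (a *: u + v) = iota a * ell u + ell v.

Lemma sum_fibers0 (I : finType) (T : eqType) (P : pred I) (h : I -> T) (F : I -> K) :
  (forall x, \sum_(i | P i && (h i == x)) F i = 0) -> \sum_(i | P i) F i = 0.
Proof.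
move=> F0; pose s := undup [seq h i | i <- enum I].
have hs i : h i \in s by rewrite mem_undup map_f // mem_enum.
transitivity (\sum_(i | P i) \sum_(x <- s) (if h i == x then F i else 0)).
  apply: eq_bigr => i _; rewrite (bigD1_seq (h i)) ?undup_uniq //= eqxx.
  by rewrite big1 ?addr0 // => x xh; rewrite eq_sym (negbTE xh).
rewrite exchange_big big1 // => x _.
by rewrite -big_mkcondr F0.
Qed.

Lemma ell0 : ell 0 = 0.
Proof.
apply: (@addrI _ (ell 0)); rewrite addr0.
by have := ell_lin 1 0 0; rewrite rmorph1 mul1r scaler0 addr0 => <-.
Qed.

Lemma ell_sum (s : seq E) (c : E -> R) :
  ell (\sum_(v <- s) c v *: v) = \sum_(v <- s) iota (c v) * ell v.
Proof.
by elim: s => [|v s IHs]; rewrite ?big_nil ?ell0 // !big_cons ell_lin IHs.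
Qed.

(** Replacing [v] by [w] in [s] multiplies the volume by [|cf s w v|]; the sign restores the
    coefficient of [v] in the expansion of [w], and [ell v] cancels. *)
Lemma term_expand (vol : seq E -> R) (s : seq E) (w : E) :
  (forall s t, perm_eq s t -> vol s = vol t) ->
  (forall a u v s, u - a *: v \in <<s>>%VS -> vol (u :: s) = `|a| * vol (v :: s)) ->
  free s -> w \in <<s>>%VS -> (forall v, v \in s -> ell v != 0) ->
  ell w * (iota (vol s) / \prod_(v <- s) ell v) =
  \sum_(v <- s) iota (Num.sg (cf s w v)) *
     (iota (vol (w :: rem v s)) / \prod_(u <- rem v s) ell u).
Proof.
move=> vol_perm vol_lin fs ws ells.
rewrite {1}(cf_sum fs ws) ell_sum mulr_suml; apply: eq_big_seq => v vs.
rewrite (vol_lin (cf s w v) w v) ?cf_sub // -(vol_perm _ _ (perm_to_rem vs)).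
rewrite (perm_big _ (perm_to_rem vs)) /= big_cons invfM.
rewrite {1}[cf s w v]numEsg !rmorphM /=.
have := ells v vs; move: (iota _) (iota `|_|) (iota (vol s)) (\prod_(j <- _) _) => a b c d.
by move: (d^-1) => {}d e0; field.
Qed.

(** [vol] is abstract, with just the properties of the absolute value of a determinant that survive
    when [w] is fixed as an additional entry, as the induction requires. *)
Theorem generic_cone_relation (k : nat) (W : {vspace E}) (vol : seq E -> R)
    (J : finType) (P : pred J) (V : J -> seq E) (c : J -> K) :
  \dim W = k ->
  (forall s t, perm_eq s t -> vol s = vol t) ->
  (forall a u v s, u - a *: v \in <<s>>%VS -> vol (u :: s) = `|a| * vol (v :: s)) ->
  (forall j, P j -> free (V j) /\ <<V j>>%VS = W) ->
  (forall j v, P j -> v \in V j -> ell v != 0) ->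
  generically W (fun p => \sum_(j | P j) c j * (incone (V j) p)%:R = 0) ->
  \sum_(j | P j) c j * (iota (vol (V j)) / \prod_(v <- V j) ell v) = 0.
Proof.
elim: k => [|k IHk] in W vol J P V c * => dW vol_perm vol_lin VW ellV gen.
  (* In dimension 0 every cone is the point 0, and the relation says that the coefficients sum to
     0. *)
  have Vnil j : P j -> V j = [::].
    by move=> /VW[fV VjW]; apply/nilP; rewrite /nilp -(eqnP fV) VjW dW.
  have [p _ sum0] := generic_ex gen.
  transitivity ((\sum_(j | P j) c j * (incone (V j) p)%:R) * iota (vol [::])).
    rewrite mulr_suml; by apply: eq_bigr => j /Vnil->; rewrite /incone big_nil invr1 !mulr1.
  by rewrite sum0 mul0r.
have szV j : P j -> size (V j) = k.+1 by move=> /VW[/eqnP<- ->].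
case: (pickP P) => [j0 Pj0|P0]; last by rewrite big_pred0.
case: gen => L [LW LP].
(* [w] avoids the exceptional subspaces of the relation, all walls, and the kernel of [ell], which
   is proper since [ell] is nonzero on a generator. *)
have [w wW [[wL wV] ellw]] : exists2 w, w \in W & ((forall U, U \in L -> ~ U w) /\
    (forall j, j \in enum J -> P j -> forall v, v \in V j -> w \notin <<rem v (V j)>>%VS)) /\
    ell w != 0.
  apply: generic_ex; apply: generic_and; first apply: generic_and.
  - by apply: generic_all => U /LW[lU [q qW Uq]]; apply: generic_notin qW Uq.
  - apply: generic_all => j _; case: (boolP (P j)) => Pj; last exact: generic_true.
    apply: (@generic_mono _ _ _ (fun p => forall v, v \in V j -> p \notin <<rem v (V j)>>%VS)) => //.
    apply: generic_all => v vV; have [fV VjW] := VW j Pj.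
    apply: generic_notinv; apply: contra (free_rem fV vV).2 => /subvP; apply.
    by rewrite -VjW memv_span.
  - have [v0 v0V] : exists v, v \in V j0.
      by have := szV _ Pj0; case: (V j0) => // v s _; exists v; exact: mem_head.
    apply: (@generic_mono _ _ _ (fun p => ~ ell p = 0)); first by move=> p _ /eqP.
    apply: (@generic_notin _ _ _ (fun p => ell p = 0) v0).
    + by move=> a u v u0 v0'; rewrite ell_lin u0 v0' mulr0 addr0.
    + by have [_ <-] := VW j0 Pj0; rewrite memv_span.
    + exact/eqP/(ellV j0).
have {}wV j v : P j -> v \in V j -> w \notin <<rem v (V j)>>%VS.
  by move=> Pj; apply: wV => //; rewrite mem_enum.
(* Walls are numbered by position, so that pairs of a cone and a wall form a finite type, the index
   type of the relation in the smaller dimension. *)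
pose wall j (i : 'I_k.+1) := (V j)`_i.
have wallV j i : P j -> wall j i \in V j by move=> Pj; rewrite mem_nth ?szV.
have sum_wall j (Q : pred E) (F : E -> K) : P j ->
    \sum_(v <- V j | Q v) F v = \sum_(i < k.+1 | Q (wall j i)) F (wall j i).
  by move=> Pj; rewrite (big_nth 0) szV // big_mkord.
apply: (mulfI ellw); rewrite mulr0 mulr_sumr.
transitivity (\sum_(j | P j) \sum_(i < k.+1) c j * (iota (Num.sg (cf (V j) w (wall j i))) *
   (iota (vol (w :: rem (wall j i) (V j))) / \prod_(u <- rem (wall j i) (V j)) ell u))).
  apply: eq_bigr => j Pj; have [fV VjW] := VW j Pj.
  rewrite mulrCA (term_expand vol_perm vol_lin) ?VjW // => [|v]; last exact: ellV.
  by rewrite sum_wall // mulr_sumr.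
rewrite pair_big_dep /=.
(* The walls are grouped by the hyperplane [H] that they span; each group vanishes by induction. *)
apply: (@sum_fibers0 _ _ _ (fun x => <<rem (wall x.1 x.2) (V x.1)>>%VS)) => H /=.
case: (pickP (fun x : J * 'I_k.+1 => P x.1 && true && (<<rem (wall x.1 x.2) (V x.1)>>%VS == H))) =>
  [x0 /andP[/andP[Px0 _] /eqP x0H]|no]; last by rewrite big_pred0.
have dimr j v : P j -> v \in V j -> \dim <<rem v (V j)>> = k.
  by move=> Pj vV; have [fV VjW] := VW j Pj; rewrite dim_rem // VjW dW.
have dH : \dim H = k by rewrite -x0H dimr // wallV.
have HW : (H <= W)%VS.
  have [_ <-] := VW _ Px0; rewrite -x0H; apply: sub_span => u; exact: mem_rem.
under eq_bigr do rewrite mulrA.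
apply: (IHk H (fun s => vol (w :: s)) _
  (fun x => P x.1 && true && (<<rem (wall x.1 x.2) (V x.1)>>%VS == H))
  (fun x => rem (wall x.1 x.2) (V x.1))
  (fun x => c x.1 * iota (Num.sg (cf (V x.1) w (wall x.1 x.2))))) => //.
- by move=> s t st; apply: vol_perm; rewrite perm_cons.
- move=> a u v s uv.
  have sw x y : vol [:: x, y & s] = vol [:: y, x & s].
    by apply: vol_perm; apply/seq.permP => Q /=; rewrite addnCA.
  rewrite sw [in RHS]sw (vol_lin a u v) //.
  by apply: (subvP (sub_span _)) uv => x; rewrite inE orbC => ->.
- move=> x /andP[/andP[Px _] /eqP xH]; split=> //.
  by have [fV _] := VW _ Px; have [] := free_rem fV (wallV x.1 x.2 Px).
- by move=> x v /andP[/andP[Px _] _] /mem_rem vV; apply: ellV vV.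
(* A generic [p] of [H] avoids the walls that span another hyperplane, since these have the same
   dimension as [H], and the faces of codimension two, whose span is too small to contain [H]. *)
have gen1 : generically H (fun p => forall j, j \in enum J -> P j -> forall v, v \in V j ->
    (<<rem v (V j)>>%VS != H -> p \notin <<rem v (V j)>>%VS)).
  apply: generic_all => j _; case: (boolP (P j)) => Pj; last exact: generic_true.
  apply: (@generic_mono _ _ _ (fun p => forall v, v \in V j ->
     (<<rem v (V j)>>%VS != H -> p \notin <<rem v (V j)>>%VS))) => //.
  apply: generic_all => v vV; case: eqVneq => [_|nH]; first exact: generic_true.
  apply: (@generic_mono _ _ _ (fun p => p \notin <<rem v (V j)>>%VS)) => //.
  apply: generic_notinv; apply: contra nH => sub.
  by move: sub; rewrite eq_sym eqEdim dH dimr ?leqnn ?andbT.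
have gen2 : generically H (fun p => forall j, j \in enum J -> P j -> forall v, v \in V j ->
    forall u, u \in rem v (V j) -> p \notin <<rem u (rem v (V j))>>%VS).
  apply: generic_all => j _; case: (boolP (P j)) => Pj; last exact: generic_true.
  apply: (@generic_mono _ _ _ (fun p => forall v, v \in V j ->
    forall u, u \in rem v (V j) -> p \notin <<rem u (rem v (V j))>>%VS)) => //.
  apply: generic_all => v vV; apply: generic_all => u uV.
  have [fV VjW] := VW j Pj; have [fr _] := free_rem fV vV.
  apply: generic_notinv; apply: contraL isT => /dimvS.
  rewrite dim_rem // dimr // dH.
  have := dimr j v Pj vV; rewrite (eqnP fr) => szr; move: uV; rewrite -szr.
  by case: (rem v (V j)) => //= a s _; rewrite ltnn.
apply: generic_mono (generic_and gen1 gen2) => p pH [p1 p2].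
have /small_all jump : forall j, j \in enum J -> small (fun t => P j ->
   (incone (V j) (p + t *: w))%:R - (incone (V j) (p + t *: - w))%:R =
    \sum_(v <- V j | <<rem v (V j)>>%VS == H)
       iota (Num.sg (cf (V j) w v)) * (incone (rem v (V j)) p)%:R :> K).
  move=> j jJ; case: (boolP (P j)) => Pj; last by exists 1.
  have [fV VjW] := VW j Pj.
  apply: small_mono (incone_jump iota fV (w := w) _ _ pH _ _ _) => //; rewrite ?VjW //.
  - by move=> v; exact: wV.
  - by move=> v vV; apply: p1.
  - by move=> v u vV; apply: p2.
(* For small [t] both [p + t *: w] and [p - t *: w] are off the exceptional subspaces because [w]
   is, even if [p] lies in some of them. *)
have /small_all gp : forall U, U \in L -> small (fun t => ~ U (p + t *: w)).
  by move=> U UL; apply: small_notin; [case: (LW U UL) | right; exact: wL].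
have /small_all gm : forall U, U \in L -> small (fun t => ~ U (p + t *: - w)).
  move=> U UL; have [lU _] := LW U UL.
  apply: small_notin => //; right=> Uw; apply: (wL U UL).
  have := lU (-1 - 1) _ _ Uw Uw.
  by rewrite -[X in _ + X]scale1r -scalerDl subrK scaleN1r opprK.
have [t _ [jt [tp tm]]] := small_ex (small_and jump (small_and gp gm)).
have pW : p \in W by apply: (subvP HW).
have sp := LP _ _ tp; have sm := LP _ _ tm.
(* The relation in [H] is the difference of the given relation at these two points. *)
transitivity (\sum_(j | P j) c j * (incone (V j) (p + t *: w))%:R -
   \sum_(j | P j) c j * (incone (V j) (p + t *: - w))%:R); last first.
  by rewrite sp ?sm ?subrr ?rpredD ?rpredZ ?rpredN.
rewrite -sumrB.
transitivity (\sum_(j | P j) \sum_(i < k.+1 | <<rem (wall j i) (V j)>>%VS == H)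
   c j * (iota (Num.sg (cf (V j) w (wall j i))) * (incone (rem (wall j i) (V j)) p)%:R)).
  rewrite pair_big_dep /=; apply: eq_big => [x|x _]; last by rewrite mulrA.
  by rewrite andbT; case: x.
apply: eq_bigr => j Pj; rewrite -mulrBr jt ?mem_enum // -mulr_sumr.
by rewrite [in RHS]sum_wall.
Qed.

End ConeValuation.

(** * The boundary of the dual cone *)

Section Support.
Variables (R : realType) (n : nat).
Implicit Types (u v y : 'rV[R]_n) (T : nonempty_subset n).

Definition some_mem T : 'I_n := xchoose (set0Pn _ (valP T)).

Lemma some_memP T : some_mem T \in val T.
Proof. exact: (xchooseP (set0Pn _ (valP T))). Qed.

Definition minT T v : R := v 0 [arg min_(i < some_mem T in val T) v 0 i]%O.

Lemma minT_eq T v i : i \in val T -> (forall k, k \in val T -> v 0 i <= v 0 k) ->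
  minT T v = v 0 i.
Proof.
rewrite /minT; case: arg_minP => [|k kT kmin iT imin]; first exact: some_memP.
by apply: le_anti; rewrite kmin // imin.
Qed.

Lemma minT_le T v i : i \in val T -> minT T v <= v 0 i.
Proof. by rewrite /minT; case: arg_minP => [|k _ kmin /kmin//]; exact: some_memP. Qed.

Lemma minT_ex T v : exists2 i, i \in val T & minT T v = v 0 i.
Proof. by rewrite /minT; case: arg_minP => [|k kT _]; [exact: some_memP | exists k]. Qed.

Lemma dotv_sum (I : finType) (y : I -> 'rV[R]_n) v :
  dotv v (\sum_i y i) = \sum_i dotv v (y i).
Proof.
rewrite /dotv exchange_big; apply: eq_bigr => k _.
by rewrite summxE mulr_sumr.
Qed.

Lemma dotvZ v t y : dotv v (t *: y) = t * dotv v y.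
Proof. by rewrite /dotv mulr_sumr; apply: eq_bigr => k _; rewrite mxE mulrCA. Qed.

Lemma dotv_delta v i : dotv v (delta_mx 0 i) = v 0 i.
Proof.
rewrite /dotv (bigD1 i) //= mxE !eqxx mulr1 big1 ?addr0 // => k /negbTE ki.
by rewrite mxE ki andbF mulr0.
Qed.

Lemma Delta_delta T i : i \in val T -> Delta T (delta_mx 0 i : 'rV[R]_n).
Proof.
move=> iT; exists 1%N, (fun=> 1), (fun=> delta_mx 0 i); split=> //.
- by rewrite big_ord1.
- by move=> _; exists i.
- by rewrite big_ord1 scale1r.
Qed.

Lemma Delta_dotv T v y : Delta T y -> minT T v <= dotv v y.
Proof.
case=> k [w [p [w0 w1 pT ->]]]; rewrite dotv_sum -[minT T v]mul1r -w1 mulr_suml.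
apply: ler_sum => j _; rewrite dotvZ ler_wpM2l //.
by have [i iT <-] := pT j; rewrite dotv_delta minT_le.
Qed.

Lemma hfun_Delta T v : hfun (@Delta R n T) v = - minT T v.
Proof.
have [i iT mi] := minT_ex T v.
congr (- _); apply/eqP; rewrite eq_le; apply/andP; split.
  rewrite mi; apply: ge_inf; first by exists (minT T v) => _ [y yT <-]; exact: Delta_dotv.
  by exists (delta_mx 0 i); [exact: Delta_delta | rewrite dotv_delta].
apply: lb_le_inf; first by exists (v 0 i), (delta_mx 0 i); [exact: Delta_delta | rewrite dotv_delta].
by move=> _ [y yT <-]; exact: Delta_dotv.
Qed.

(* Minus the support function of the Minkowski sum of all the [Delta T]. *)
Definition phi v : R := \sum_T minT T v.

(** [phi v] is the minimum of [dotv v] on the Minkowski sum, attained at a sum of vertices, one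
    minimising [dotv v] on each [Delta T]. *)
Lemma phi_dual_cone v :
  dual_cone (cone (minkowski_sum (@Delta R n))) v <-> 0 <= phi v.
Proof.
split=> [|phi0 _ [t [_ [t0 [p pT ->] ->]]]]; last first.
  rewrite dotvZ mulr_ge0 // dotv_sum (le_trans phi0) //.
  by apply: ler_sum => T _; exact: Delta_dotv.
pose p T : 'rV[R]_n := delta_mx 0 [arg min_(i < some_mem T in val T) v 0 i]%O.
have -> : phi v = dotv v (1 *: \sum_T p T).
  by rewrite scale1r dotv_sum; apply: eq_bigr => T _; rewrite dotv_delta.
apply; exists 1, (\sum_T p T); split=> //; exists p => // T.
apply: Delta_delta; case: arg_minP => //; exact: some_memP.
Qed.

Lemma minT_shift T u v e : (forall i, v 0 i - e <= u 0 i) -> minT T v - e <= minT T u.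
Proof.
move=> uv; have [i iT ->] := minT_ex T u; apply: le_trans (uv i).
by rewrite lerD2r minT_le.
Qed.

Lemma phi_shift u v e : (forall i, v 0 i - e <= u 0 i) ->
  phi v - e * #|nonempty_subset n|%:R <= phi u.
Proof.
move=> uv; rewrite mulr_natr -sumr_const -sumrB.
by apply: ler_sum => T _; exact: minT_shift.
Qed.

Lemma minT_const T v t : minT T (v + const_mx t) = minT T v + t.
Proof.
have [i iT mi] := minT_ex T v; rewrite mi (@minT_eq _ _ i) ?mxE // => k kT.
by rewrite !mxE lerD2r -mi minT_le.
Qed.

Lemma phi_const v t : phi (v + const_mx t) = phi v + t * #|nonempty_subset n|%:R.
Proof.
rewrite mulr_natr -sumr_const -big_split; apply: eq_bigr => T _; exact: minT_const.
Qed.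

Lemma minT_sum T (s : seq 'rV[R]_n) : \sum_(u <- s) minT T u <= minT T (\sum_(u <- s) u).
Proof.
have [i iT ->] := minT_ex T (\sum_(u <- s) u); rewrite summxE.
by apply: ler_sum => u _; exact: minT_le.
Qed.

Lemma nonempty_subset_gt0 : (0 < n)%N -> 0 < #|nonempty_subset n|%:R :> R.
Proof.
move=> n0; rewrite ltr0n; apply/card_gt0P.
have i0 : [set Ordinal n0]%SET != finset.set0 by apply/set0Pn; exists (Ordinal n0); rewrite inE.
by exists (exist (fun T : {set 'I_n} => T != finset.set0) _ i0).
Qed.

(** [phi] is Lipschitz for the sup norm, with constant [N], so [phi v > 0] gives interior points and
    [phi v < 0] exterior ones. If [phi v = 0], subtracting a small constant vector makes [phi]
    negative. *)
Lemma boundary_phi v : (0 < n)%N ->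
  boundary (dual_cone (cone (minkowski_sum (@Delta R n)))) v <-> phi v = 0.
Proof.
move=> /nonempty_subset_gt0; set N := #|_|%:R => N0; set A := dual_cone _.
have near e u : ball v e u -> phi v - e * N <= phi u /\ phi u - e * N <= phi v.
  by move=> [_ vu]; split; apply: phi_shift => i; have := vu 0 i;
     rewrite /ball/= ltr_norml => /andP[? ?]; lra.
split=> [[cl ni]|v0]; last first.
  split; first by apply: subset_closure; apply/phi_dual_cone; rewrite v0.
  move=> /nbhs_ballP[e /= e0 /(_ (v + const_mx (- (e / 2))))].
  have b : ball v e (v + const_mx (- (e / 2))).
    split=> [//|i j]; rewrite /ball /= !mxE (_ : _ - _ = e / 2); last by lra.
    by rewrite gtr0_norm; lra.
  move=> /(_ b)/phi_dual_cone; rewrite phi_const v0 add0r.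
  by rewrite leNgt => /negP; apply; rewrite pmulr_llt0 //; lra.
case: (ltrgt0P (phi v)) => // v0.
  case: ni; apply/nbhs_ballP; exists (phi v / N) => /=; first exact: divr_gt0.
  by move=> u /near[+ _]; rewrite divfK ?gt_eqF // subrr => /phi_dual_cone.
(* In this ball [phi] is at most [phi v / 2], hence negative. *)
have /cl[u [/phi_dual_cone u0 /near[_]]] : nbhs v (ball v (- phi v / (2 * N))).
  by apply: nbhsx_ballx; rewrite divr_gt0 ?mulr_gt0 ?oppr_gt0.
have -> : - phi v / (2 * N) * N = - phi v / 2 by field; rewrite gt_eqF.
by lra.
Qed.

End Support.

(** * Chambers of the braid arrangement *)

Section Chambers.
Variables (R : realType) (m : nat).
Local Notation n := m.+1.
Implicit Types (u v : 'rV[R]_n) (T : nonempty_subset n) (sigma : 'S_n).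

(** Coordinates decrease weakly along [sigma], so that the initial images of [sigma] are the sets of
    largest coordinates. *)
Definition chamber sigma v : Prop :=
  forall a b : 'I_n, (a <= b)%N -> v 0 (sigma b) <= v 0 (sigma a).

Lemma chamber_ex v : exists sigma, chamber sigma v.
Proof.
pose leT (i j : 'I_n) := v 0 j <= v 0 i.
have /tuple_permP[sigma Es] : perm_eq (sort leT (ord_tuple n)) (ord_tuple n).
  by rewrite perm_sort.
have nthE (a : 'I_n) : nth ord0 (sort leT (ord_tuple n)) a = sigma a.
  by rewrite Es -tnth_nth tnth_mktuple tnth_ord_tuple.
exists sigma => a b ab; rewrite -!nthE.
have tr : transitive leT by move=> x y z xy yz; apply: le_trans yz xy.
have rf : reflexive leT by move=> x; apply: lexx.
have tot : total leT by move=> x y; apply: le_total.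
by apply: (sorted_leq_nth tr rf ord0 (sort_sorted tot _)) => //;
  rewrite inE size_sort size_tuple.
Qed.

(** The element of [T] that [sigma] lists last; on the whole chamber the minimum over [T] is
    attained there, which makes [minT T] linear on the chamber. *)
Definition lowest sigma T : 'I_n :=
  [arg max_(i > some_mem T in val T) (sigma^-1%g i : nat)].

Lemma lowestP sigma T : lowest sigma T \in val T /\
  forall i, i \in val T -> (sigma^-1%g i <= sigma^-1%g (lowest sigma T))%N.
Proof. by rewrite /lowest; case: arg_maxnP => [|i iT ile]; [exact: some_memP | split]. Qed.

Lemma minT_chamber sigma T v : chamber sigma v -> minT T v = v 0 (lowest sigma T).
Proof.
move=> cv; have [lT lmax] := lowestP sigma T; apply: minT_eq => // k /lmax /cv.
by rewrite !permKV.
Qed.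

Lemma phi_chamber sigma v : chamber sigma v -> phi v = \sum_T v 0 (lowest sigma T).
Proof. by move=> cv; apply: eq_bigr => T _; exact: minT_chamber. Qed.

(* Superadditivity of each [minT T]: where [phi] is additive, all the minima
   are attained at common places, so that a permutation sorting the sum sorts
   every summand. *)
Lemma common_chamber (s : seq 'rV[R]_n) :
  (forall u, u \in s -> phi u = 0) -> phi (\sum_(u <- s) u) = 0 ->
  exists sigma, forall u, u \in s -> chamber sigma u.
Proof.
move=> s0 sum0; have [sigma cs] := chamber_ex (\sum_(u <- s) u).
exists sigma => u us a b ab.
have iT : sigma b \in [set sigma a; sigma b]%SET by rewrite !inE eqxx orbT.
have T0 : [set sigma a; sigma b]%SET != finset.set0 by apply/set0Pn; exists (sigma b).
(* On this pair the sum of the family attains its minimum at [sigma b]; equality in superadditivity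
   forces every summand to do so too. *)
pose T : nonempty_subset n := exist (fun T : {set 'I_n} => T != finset.set0) _ T0.
have sumT : \sum_(u <- s) minT T u = minT T (\sum_(u <- s) u).
  apply/eqP; rewrite -subr_eq0 -oppr_eq0 opprB; apply/eqP.
  pose F T := minT T (\sum_(u <- s) u) - \sum_(u <- s) minT T u.
  have F0 U : 0 <= F U by rewrite subr_ge0 minT_sum.
  apply: (@psumr_eq0P _ _ xpredT F) => //.
  rewrite sumrB exchange_big /= -/(phi _) sum0 sub0r big_seq big1 ?oppr0 //.
have mb : minT T (\sum_(u <- s) u) = (\sum_(u <- s) u) 0 (sigma b).
  by apply: minT_eq => // k; rewrite !inE => /orP[]/eqP->; rewrite ?lexx ?cs.
have le0 (w : 'rV[R]_n) : 0 <= w 0 (sigma b) - minT T w by rewrite subr_ge0 minT_le.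
have /eqP : \sum_(w <- s) (w 0 (sigma b) - minT T w) = 0.
  by rewrite sumrB sumT mb summxE subrr.
rewrite psumr_eq0 => // /allP/(_ u us) /=; rewrite subr_eq0 => /eqP->.
by rewrite minT_le //= !inE eqxx.
Qed.

Lemma mem_initial_image sigma i a : (i \in initial_image sigma a) = (sigma^-1%g i < a)%N.
Proof.
by rewrite /initial_image -{1}(permKV sigma i) mem_imset ?inE //; exact: perm_inj.
Qed.

Definition indic (S : {set 'I_n}) : 'rV[R]_n := \row_i (i \in S)%:R.

(* The extreme ray of the dual cone in the direction of [indic S]. *)
Definition ray (S : {set 'I_n}) : 'rV[R]_n :=
  indic S - const_mx (phi (indic S) / #|nonempty_subset n|%:R).

Lemma rayE S i : ray S 0 i = (i \in S)%:R - phi (indic S) / #|nonempty_subset n|%:R.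
Proof. by rewrite !mxE. Qed.

Lemma phi_ray S : phi (ray S) = 0.
Proof.
have -> : ray S = indic S + const_mx (- (phi (indic S) / #|nonempty_subset n|%:R)).
  by apply/rowP => i; rewrite !mxE.
rewrite phi_const mulNr divfK ?subrr // gt_eqF //; exact: nonempty_subset_gt0.
Qed.

Lemma chamber_ray sigma a : chamber sigma (ray (initial_image sigma a)).
Proof.
move=> b c bc; rewrite !rayE lerD2r !mem_initial_image !permK ler_nat.
by case: (ltnP c a) => // ca; rewrite (leq_ltn_trans bc ca).
Qed.

Lemma chamberZD sigma (t : R) u v :
  0 <= t -> chamber sigma u -> chamber sigma v -> chamber sigma (t *: u + v).
Proof. by move=> t0 cu cv a b ab; rewrite !mxE lerD ?cv // ler_wpM2l ?cu. Qed.

(** Initial images of sizes 1 to m only: the empty and the full set would give the zero vector. *)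
Definition rays sigma : seq 'rV[R]_n :=
  [seq ray (initial_image sigma a.+1) | a <- iota 0 m].

Lemma size_rays sigma : size (rays sigma) = m.
Proof. by rewrite size_map size_iota. Qed.

Lemma nth_rays sigma a : (a < m)%N -> (rays sigma)`_a = ray (initial_image sigma a.+1).
Proof. by move=> am; rewrite (nth_map 0%N) ?size_iota // nth_iota. Qed.

(** Abel summation gives the equality up to a constant vector. [phi] vanishes on both sides, being
    linear on the chamber, and it grows strictly along constants, so the constant is 0. *)
Lemma sorted_decomposition sigma v : phi v = 0 -> chamber sigma v ->
  v = \sum_(a < m) (v 0 (sigma (inord a)) - v 0 (sigma (inord a.+1))) *: (rays sigma)`_a.
Proof.
move=> v0 cv; set w := \sum_(a < m) _.
have cw : chamber sigma w.
  rewrite /w; elim/big_rec: _ => [|a x _ cx]; first by move=> *; rewrite !mxE.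
  apply: chamberZD cx; last by rewrite nth_rays //; exact: chamber_ray.
  by rewrite subr_ge0 cv // !inordK // ltnS // ltnW.
have w0 : \sum_T w 0 (lowest sigma T) = 0.
  under eq_bigr do rewrite summxE; rewrite exchange_big big1 // => a _.
  under eq_bigr do rewrite mxE.
  rewrite -mulr_sumr nth_rays // -phi_chamber ?phi_ray ?mulr0 //; exact: chamber_ray.
(* The last term of the Abel summation plus the constants subtracted in the rays. *)
pose kappa := v 0 (sigma ord_max) +
   \sum_(a < m) (v 0 (sigma (inord a)) - v 0 (sigma (inord a.+1))) *
     (phi (indic (initial_image sigma a.+1)) / #|nonempty_subset n|%:R).
have vw i : v 0 i - w 0 i = kappa.
  rewrite -(permKV sigma i); move: (sigma^-1%g i) => {i} b.
  rewrite summxE /kappa.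
  under eq_bigr => a _ do rewrite mxE nth_rays // rayE mulrBr mem_initial_image permK.
  rewrite sumrB opprB addrCA addrC; congr (_ + _); apply/eqP; rewrite subr_eq; apply/eqP.
  pose f a := v 0 (sigma (inord a)).
  rewrite -(big_mkord xpredT (fun a => (f a - f a.+1) * (b < a.+1)%:R)).
  have bm : (b <= m)%N by rewrite -ltnS.
  (* Only the indices [a >= b] contribute, and there the sum telescopes to [f b - f m]. *)
  rewrite (big_cat_nat (n := b)) //= big_nat big1 ?add0r => [|a /andP[_ ab]]; last first.
    by rewrite ltnNge ab mulr0.
  rewrite (eq_big_nat _ _ (F2 := fun a => - (f a.+1 - f a))) => [|a /andP[ba _]]; last first.
    by rewrite ltnS ba mulr1 opprB.
  rewrite sumrN telescope_sumr // opprB /f inord_val addrC.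
  by rewrite (_ : inord m = ord_max) ?subrK //; apply: val_inj; rewrite /= inordK.
have : kappa * #|nonempty_subset n|%:R = 0.
  transitivity (\sum_T v 0 (lowest sigma T) - \sum_T w 0 (lowest sigma T)).
    by rewrite mulr_natr -sumr_const -sumrB; apply: eq_bigr => T _; rewrite vw.
  by rewrite w0 -(phi_chamber cv) v0 subrr.
move/eqP; rewrite mulf_eq0 [X in _ || X]gt_eqF ?orbF; last exact: nonempty_subset_gt0.
by move/eqP=> k0; apply/rowP => i; apply/eqP; rewrite -subr_eq0 vw k0.
Qed.

End Chambers.

(** * Volumes *)

Section Volume.
Variables (R : realType) (m : nat).
Local Notation n := m.+1.
Implicit Types (s t : seq 'rV[R]_n) (u v : 'rV[R]_n) (sigma : 'S_n).

Definition mxseq s : 'M[R]_n := \matrix_(a < n) s`_a.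

Lemma normdet_perm s t : size s = n -> perm_eq s t -> `|\det (mxseq s)| = `|\det (mxseq t)|.
Proof.
move=> ss st; have tn : size t == n by rewrite -(perm_size st) ss.
have /tuple_permP[p sp] : perm_eq s (Tuple tn) by [].
have -> : mxseq s = row_perm p (mxseq t).
  by apply/matrixP => a b; rewrite !mxE sp -tnth_nth tnth_mktuple (tnth_nth 0).
by rewrite row_permE det_mulmx det_perm normrM normr_sign mul1r.
Qed.

Lemma det_head (a : R) u v s :
  \det (mxseq (a *: u + v :: s)) = a * \det (mxseq (u :: s)) + \det (mxseq (v :: s)).
Proof.
rewrite -[\det (mxseq (v :: s))]mul1r; apply: (determinant_multilinear (i0 := ord0)).
- by rewrite !rowK scale1r.
- by apply/matrixP => i j; rewrite !mxE.
- by apply/matrixP => i j; rewrite !mxE.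
Qed.

(** Expanding [u] along [s] leaves determinants with two equal rows; the bound on the size ensures
    that every vector of [s] is a row of the matrix. *)
Lemma det_head_span s t u : (size (s ++ t) <= m)%N -> u \in <<s>>%VS ->
  \det (mxseq (u :: s ++ t)) = 0.
Proof.
move=> szs us; rewrite (@coord_span _ _ _ (in_tuple s) u us).
have D0 : \det (mxseq (0 :: s ++ t)) = 0.
  by have := det_head (-1) 0 0 (s ++ t); rewrite scaler0 addr0 mulN1r addNr.
elim/big_rec: _ => // i v _ v0; rewrite det_head v0 addr0.
rewrite (_ : \det _ = 0) ?mulr0 //.
have lt_i : (i.+1 < n)%N.
  by rewrite ltnS (leq_trans (ltn_ord i)) // (leq_trans _ szs) // size_cat leq_addr.
apply: (determinant_alternate (i1 := ord0) (i2 := Ordinal lt_i)) => // k.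
by rewrite !mxE /= nth_cat ltn_ord.
Qed.

(* Zero unless [s] has the right length, which makes the next two lemmas
   unconditional. *)
Definition wvol s : R :=
  if size s == m then `|\det (mxseq (rcons s (const_mx 1)))| else 0.

Lemma wvol_perm s t : perm_eq s t -> wvol s = wvol t.
Proof.
move=> st; rewrite /wvol -(perm_size st); case: eqP => // sm.
by apply: normdet_perm; rewrite ?size_rcons ?sm // -!cats1 perm_cat2r.
Qed.

Lemma wvol_lin (a : R) u v s : u - a *: v \in <<s>>%VS -> wvol (u :: s) = `|a| * wvol (v :: s).
Proof.
rewrite /wvol /= => us; case: eqP => [sm|]; last by rewrite mulr0.
rewrite -normrM; congr `|_|.
rewrite -{1}[u](subrK (a *: v)) [X in X :: _]addrC det_head -!cats1 (det_head_span _ us) ?addr0 //.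
by rewrite cats1 size_rcons sm.
Qed.

(** A vector in the span of the others can be replaced by 0, by [wvol_lin] with coefficient 0. *)
Lemma wvol_free s : wvol s != 0 -> free s.
Proof.
move=> w0; rewrite (freeE (in_tuple s)); apply/forallP => i; apply: contraNN w0 => si.
have st : perm_eq s (s`_i :: take i s ++ drop i.+1 s).
  by rewrite -[X in perm_eq X](cat_take_drop i) (drop_nth 0) // perm_catC /= perm_cons perm_catC.
rewrite (wvol_perm st) (@wvol_lin 0 _ 0) ?normr0 ?mul0r //.
rewrite scale0r subr0; apply: (subvP (sub_span _)) si => x xs.
by rewrite mem_cat xs orbT.
Qed.

Lemma wvol_rays sigma : wvol (rays R sigma) = 1.
Proof.
rewrite /wvol size_rays eqxx.
(* With its columns permuted, [T] has as rows the indicators of the initial images of sizes 1 to n,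
   the last one being all ones. [L] subtracts [c a] times this last row from row [a]; as [c] is 0 at
   the last index, [L] and [T] are both unitriangular. *)
pose c (a : 'I_n) : R := if (a < m)%N then
  phi (indic R (initial_image sigma a.+1)) / #|nonempty_subset n|%:R else 0.
pose L : 'M[R]_n := \matrix_(a, b) ((a == b)%:R - (b == ord_max)%:R * c a).
pose T : 'M[R]_n := \matrix_(a, b) (b <= a)%N%:R.
have -> : mxseq (rcons (rays R sigma) (const_mx 1)) = L *m col_perm sigma^-1 T.
  apply/matrixP => a i; rewrite !mxE.
  under eq_bigr do rewrite !mxE mulrBl.
  rewrite sumrB (bigD1 a) //= eqxx mul1r big1 ?addr0 => [|b]; last first.
    by rewrite eq_sym => /negbTE->; rewrite mul0r.
  rewrite (bigD1 ord_max) //= eqxx mul1r big1 ?addr0 => [|b /negbTE->]; last by rewrite !mul0r.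
  rewrite /= leq_ord mulr1 nth_rcons size_rays /c; case: ltnP => am.
    by rewrite nth_rays // rayE mem_initial_image.
  have -> : (a : nat) = m by apply/eqP; rewrite eqn_leq am -ltnS ltn_ord.
  by rewrite eqxx mxE -ltnS ltn_ord subr0.
rewrite col_permE !det_mulmx det_perm mulrA normrM normr_sign mulr1.
rewrite -det_tr !det_trig.
- rewrite !big1 ?mulr1 ?normr1 // => i _; rewrite !mxE ?leqnn // eqxx /c.
  case: eqP => [->|_]; last by rewrite mul0r subr0.
  by rewrite ltnn mulr0 subr0.
- by apply/is_trig_mxP => i j ij; rewrite mxE leqNgt ij.
- apply/is_trig_mxP => i j ij; rewrite !mxE -!val_eqE /= gtn_eqF // ltn_eqF ?mul0r ?subr0 //.
  by rewrite (leq_trans ij) // -ltnS.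
Qed.

Lemma free_rays sigma : free (rays R sigma).
Proof. by apply: wvol_free; rewrite wvol_rays oner_eq0. Qed.

End Volume.

(** * Cells of a triangulation of the boundary *)

Lemma span_ge0P (R : realType) (n : nat) (s : seq 'rV[R]_n) (p : 'rV[R]_n) : free s ->
  span_ge0 s p <-> p \in <<s>>%VS /\ incone s p.
Proof.
move=> fs; split=> [[c c0 ->]|[ps /allP ip]]; last first.
  exists (fun i => cf s p s`_i); first by move=> i; apply: ip; rewrite mem_nth.
  by rewrite {1}(cf_sum fs ps) (big_nth 0) big_mkord.
split; first by apply: rpred_sum => i _; rewrite rpredZ // memv_span // mem_nth.
apply/allP => v /(nthP 0)[i lt_i <-]; rewrite (cf_nth _ (Ordinal lt_i)) ?free_uniq //.
by rewrite (coord_sum_free (X := in_tuple s) c).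
Qed.

Lemma span_ge0_mem (R : realType) (n : nat) (s : seq 'rV[R]_n) (v : 'rV[R]_n) :
  v \in s -> span_ge0 s v.
Proof.
move=> /(nthP 0)[i lt_i <-]; exists (fun j => (j == Ordinal lt_i)%:R); first by move=> j; rewrite ler0n.
rewrite (bigD1 (Ordinal lt_i)) //= eqxx scale1r big1 ?addr0 // => j /negbTE->.
by rewrite scale0r.
Qed.

Lemma span_ge0_sum (R : realType) (n : nat) (s : seq 'rV[R]_n) :
  span_ge0 s (\sum_(v <- s) v).
Proof.
exists (fun=> 1) => //; rewrite (big_nth 0) big_mkord.
by apply: eq_bigr => i _; rewrite scale1r.
Qed.

Section Cells.
Variables (R : realType) (m : nat).
Local Notation n := m.+1.
Implicit Types (u v p : 'rV[R]_n) (T : nonempty_subset n) (sigma tau : 'S_n).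

(** One inclusion is [sorted_decomposition]; the other holds since [phi] is linear on the chamber
    and vanishes on the rays. *)
Lemma span_ge0_rays sigma p :
  span_ge0 (rays R sigma) p <-> chamber sigma p /\ phi p = 0.
Proof.
split=> [[c c0 ->]|[cp p0]]; last first.
  rewrite (sorted_decomposition p0 cp).
  exists (fun a => p 0 (sigma (inord a)) - p 0 (sigma (inord a.+1))).
    move=> a; have am : (a < m)%N by rewrite -[X in (_ < X)%N](size_rays R sigma).
    by rewrite subr_ge0 cp // !inordK // ltnS // ltnW.
  rewrite -!(big_mkord xpredT (fun a =>
    (p 0 (sigma (inord a)) - p 0 (sigma (inord a.+1))) *: (rays R sigma)`_a)).
  by rewrite size_rays.
have cw (I : finType) (f : I -> R) (g : I -> 'rV[R]_n) : (forall i, 0 <= f i) ->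
    (forall i, chamber sigma (g i)) -> chamber sigma (\sum_i f i *: g i).
  move=> f0 cg; elim/big_rec: _ => [|i x _ cx]; first by move=> *; rewrite !mxE.
  exact: chamberZD.
have cr (i : 'I_(size (rays R sigma))) : chamber sigma (rays R sigma)`_i.
  have im : (i < m)%N by rewrite -[X in (_ < X)%N](size_rays R sigma).
  by rewrite nth_rays //; exact: chamber_ray.
split; first exact: cw.
rewrite (phi_chamber (cw _ _ _ c0 cr)).
under eq_bigr do rewrite summxE; rewrite exchange_big big1 // => a _.
under eq_bigr do rewrite mxE.
rewrite -mulr_sumr -phi_chamber // nth_rays ?phi_ray ?mulr0 //.
by rewrite -[X in (_ < X)%N](size_rays R sigma).
Qed.

Lemma card_initial_image sigma (a : 'I_n) : #|initial_image sigma a| = a.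
Proof.
rewrite card_imset; last exact: perm_inj.
rewrite cardsE -sum1_card (eq_bigl (fun i : 'I_n => (i < a)%N)) //.
by rewrite (big_ord_narrow (ltnW (ltn_ord a))) sum1_card card_ord.
Qed.

(** When the coordinates are distinct, the position of [k] is the number of coordinates larger than
    [p 0 k], which does not depend on the permutation. *)
Lemma chamber_uniq sigma tau p : chamber sigma p -> chamber tau p ->
  (forall a b, a != b -> p 0 (sigma a) != p 0 (sigma b)) -> sigma = tau.
Proof.
move=> cs ct ne.
have inj i j : p 0 i = p 0 j -> i = j.
  move=> pij; apply: (@perm_inj _ sigma^-1%g); apply/eqP; apply: contraT => /ne.
  by rewrite !permKV pij eqxx.
have up rho : chamber rho p -> forall a : 'I_n,
    initial_image rho a = [set k | p 0 (rho a) < p 0 k]%SET.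
  move=> cr a; apply/setP => k; rewrite mem_initial_image inE.
  rewrite -[in RHS](permKV rho k); move: (rho^-1%g k) => b.
  case: ltnP => [ba|/cr]; last by rewrite leNgt => /negbTE->.
  rewrite lt_neqAle cr 1?ltnW // andbT; apply/esym/eqP => /inj/perm_inj ab.
  by rewrite ab ltnn in ba.
have val_inv rho : chamber rho p -> forall k,
    (rho^-1%g k : nat) = #|[set l | p 0 k < p 0 l]%SET|.
  by move=> cr k; rewrite -(card_initial_image rho) up // permKV.
apply: invg_inj; apply/permP => k; apply: val_inj.
by rewrite /= (val_inv sigma cs) (val_inv tau ct).
Qed.

Lemma subseq_full (X : eqType) (s t : seq X) :
  subseq s t -> uniq t -> {subset t <= s} -> s = t.
Proof.
move=> st ut ts; apply/eqP; rewrite -(size_subseq_leqif st) eqn_leq size_subseq //=.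
exact: uniq_leq_size.
Qed.

Section Triangulation.
Variables (J : finType) (V : J -> m.-tuple 'rV[R]_n).
Hypothesis hV : triangulation V
  (boundary (dual_cone (cone (minkowski_sum (@Delta R n))))).

Lemma cell_free j : free (V j).
Proof. by case: hV. Qed.

Lemma cells_cover p : phi p = 0 <-> exists j, span_ge0 (V j) p.
Proof.
have [_ _ cov _] := hV; have pB := @boundary_phi R n p isT.
split=> [/pB|[j jp]]; first by rewrite -cov => -[j _ jp]; exists j.
by apply/pB; rewrite -cov; exists j.
Qed.

(** The generators and their sum lie in the cell, hence on the boundary, where [phi] vanishes; so
    [common_chamber] applies. *)
Lemma cell_chamber j : exists sigma, forall u, u \in V j -> chamber sigma u.
Proof.
apply: common_chamber => [u uV|]; apply/cells_cover; exists j.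
  exact: span_ge0_mem.
exact: span_ge0_sum.
Qed.

Lemma chamber_cell j sigma p : (forall u, u \in V j -> chamber sigma u) ->
  span_ge0 (V j) p -> chamber sigma p.
Proof.
move=> cV [c c0 ->]; elim/big_rec: _ => [|i x _ cx]; first by move=> *; rewrite !mxE.
by apply: chamberZD => //; apply: cV; rewrite mem_nth.
Qed.

Lemma cell_span j sigma : (forall u, u \in V j -> chamber sigma u) ->
  <<V j>>%VS = <<rays R sigma>>%VS.
Proof.
move=> cV; apply/eqP; rewrite eqEdim (eqnP (cell_free j)) (eqnP (free_rays R sigma)).
rewrite size_rays size_tuple leqnn andbT; apply/span_subvP => u uV.
have u0 : phi u = 0 by apply/cells_cover; exists j; exact: span_ge0_mem.
by have /(span_ge0P _ (free_rays R sigma))[] : span_ge0 (rays R sigma) u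
  by apply/span_ge0_rays; split=> //; exact: cV.
Qed.

(** The common face of the two cells contains [p]. As [p] is on no wall, this face is all of both
    cells, and distinct indices have distinct cells. *)
Lemma cell_uniq j k p : span_ge0 (V j) p -> span_ge0 (V k) p ->
  (forall v, v \in V j -> p \notin <<rem v (V j)>>%VS) ->
  (forall v, v \in V k -> p \notin <<rem v (V k)>>%VS) -> j = k.
Proof.
move=> jp kp pj pk; have [_ inj _ /(_ j k)[s [t [sV tV st_s s_t]]]] := hV.
have face_full l (r : seq 'rV[R]_n) : subseq r (V l) -> span_ge0 r p ->
    (forall v, v \in V l -> p \notin <<rem v (V l)>>%VS) -> r = V l.
  move=> rV [c _ pr] pl; have ul := free_uniq (cell_free l).
  apply: subseq_full => // v vV; apply: contraT => vr.
  case/negP: (pl v vV); rewrite pr; apply: rpred_sum => i _; rewrite rpredZ // memv_span //.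
  rewrite rem_filter // mem_filter /= (mem_subseq rV) ?mem_nth // andbT.
  by apply: contraNneq vr => <-; rewrite mem_nth.
have ps : span_ge0 s p by rewrite -st_s.
have pt : span_ge0 t p by rewrite -s_t.
apply: inj; rewrite -(face_full _ _ sV ps pj) -(face_full _ _ tV pt pk).
exact: s_t.
Qed.

(** Cells labelled [sigma] lie in the cone on the rays. A generic point of that cone is in some
    cell; having distinct coordinates it belongs to one chamber only, so this cell is labelled
    [sigma]. Being off the walls, it is in only one such cell. *)
Lemma generic_fan (K : fieldType) sigma (s : J -> 'S_n) :
  (forall j u, u \in V j -> chamber (s j) u) ->
  generically <<rays R sigma>>%VS (fun p =>
    \sum_(j | s j == sigma) (incone (V j) p)%:R = (incone (rays R sigma) p)%:R :> K).
Proof.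
move=> sV; have fr := free_rays R sigma.
have gen1 : generically <<rays R sigma>>%VS (fun p =>
    forall ab : 'I_n * 'I_n, ab \in [seq x : 'I_n * 'I_n <- enum {: 'I_n * 'I_n} | (x.1 < x.2)%N] ->
      p 0 (sigma ab.1) <> p 0 (sigma ab.2)).
  apply: generic_all => -[a b]; rewrite mem_filter /= => /andP[ab _].
  have am : (a < m)%N by rewrite (leq_trans ab) // -ltnS.
  (* This ray has different coordinates at [sigma a] and [sigma b], since a < a+1 <= b. *)
  apply: (@generic_notin _ _ _ (fun p : 'rV[R]_n => p 0 (sigma a) = p 0 (sigma b))
    (ray R (initial_image sigma a.+1))).
  - by move=> t u v uab vab; rewrite !mxE uab vab.
  - by apply: memv_span; apply/mapP; exists (a : nat); rewrite // mem_iota.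
  - rewrite !rayE !mem_initial_image !permK ltnSn ltnS leqNgt ab => /addIr /eqP.
    by rewrite oner_eq0.
have gen2 : generically <<rays R sigma>>%VS (fun p => forall j, j \in enum J -> s j = sigma ->
    forall v, v \in V j -> p \notin <<rem v (V j)>>%VS).
  apply: generic_all => j _; case: (eqVneq (s j) sigma) => sj; last first.
    by apply: generic_true => p _ sj'; rewrite sj' eqxx in sj.
  apply: (@generic_mono _ _ _ (fun p => forall v, v \in V j -> p \notin <<rem v (V j)>>%VS)) => //.
  apply: generic_all => v vV; apply: generic_notinv.
  apply: contra (free_rem (cell_free j) vV).2 => /subvP; apply.
  by rewrite -sj -(cell_span (sV j)) memv_span.
apply: generic_mono (generic_and gen1 gen2) => p pW [p1 p2].
have cell j : s j = sigma -> incone (V j) p -> span_ge0 (V j) p.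
  move=> sj jp; apply/(span_ge0P _ (cell_free j)).
  by rewrite (cell_span (sV j)) sj.
have {}p2 j v : s j = sigma -> v \in V j -> p \notin <<rem v (V j)>>%VS.
  by move=> sj; apply: p2 => //; rewrite mem_enum.
case: (pickP (fun j => (s j == sigma) && incone (V j) p)) => [j /andP[/eqP sj jp]|no].
  rewrite (bigD1 j) ?sj //= jp big1 ?addr0 => [|k /andP[/eqP sk kj]]; last first.
    case: (boolP (incone _ _)) => // kp; case/eqP: kj.
    by apply: (cell_uniq (cell k sk kp) (cell j sj jp)) => v; exact: p2.
  have /(span_ge0P _ fr)[_ ->] // : span_ge0 (rays R sigma) p.
  apply/span_ge0_rays; split; last by apply/cells_cover; exists j; exact: cell.
  by apply: (@chamber_cell j); [move=> u; rewrite -sj; exact: sV | exact: cell].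
rewrite big1 => [|j sj]; last by have := no j; rewrite /= sj => /= ->.
case: (boolP (incone _ _)) => // ip.
have /span_ge0_rays[cp /cells_cover[j jp]] : span_ge0 (rays R sigma) p.
  exact/(span_ge0P _ fr).
have [_ ipj] := (span_ge0P _ (cell_free j)).1 jp.
have := no j; rewrite /= ipj andbT => /eqP[]; apply/esym.
apply: (chamber_uniq cp (chamber_cell (sV j) jp)) => a b.
rewrite neq_ltn => /orP[ab|ba]; apply/eqP.
  by apply: (p1 (a, b)); rewrite mem_filter /= ab mem_enum.
by apply/nesym; apply: (p1 (b, a)); rewrite mem_filter /= ba mem_enum.
Qed.

End Triangulation.

End Cells.

(** * Summation over the cells *)

Section CellSums.
Variables (R : realType) (m : nat).
Local Notation n := m.+1.
Variables (J : finType) (V : J -> m.-tuple 'rV[R]_n).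
Hypothesis hV : triangulation V
  (boundary (dual_cone (cone (minkowski_sum (@Delta R n))))).
Variables (K : fieldType) (iota : {rmorphism R -> K}).
Variable y : nonempty_subset n -> K.

Definition lform (v : 'rV[R]_n) : K := \sum_T y T * iota (hfun (@Delta R n T) v).

Hypothesis lform_neq0 : forall v, v != 0 -> phi v = 0 -> lform v != 0.

(** This is [generic_cone_relation] with coefficient 1 on the cells labelled [sigma] and -1 on the
    cone on [rays R sigma], whose volume is 1. *)
Lemma chamber_cells_sum sigma (s : J -> 'S_n) :
  (forall j u, u \in V j -> chamber (s j) u) ->
  \sum_(j | s j == sigma) iota (wvol (V j)) / \prod_(v <- V j) lform v =
  (\prod_(v <- rays R sigma) lform v)^-1.
Proof.
move=> sV.
(* [lform] is only piecewise linear; [ell] extends its restriction to the chamber of [sigma]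
   linearly. *)
pose ell (v : 'rV[R]_n) := \sum_T y T * iota (- v 0 (lowest sigma T)).
have ellE v : chamber sigma v -> lform v = ell v.
  by move=> cv; apply: eq_bigr => T _; rewrite hfun_Delta (minT_chamber T cv).
have ell_lin a u v : ell (a *: u + v) = iota a * ell u + ell v.
  rewrite /ell mulr_sumr -big_split; apply: eq_bigr => T _.
  by rewrite !mxE opprD -mulrN rmorphD rmorphM /=; ring.
have fr := free_rays R sigma.
have ray0 v : v \in rays R sigma -> chamber sigma v /\ phi v = 0.
  by move=> /span_ge0_mem/span_ge0_rays.
have cell0 j v : v \in V j -> phi v = 0.
  by move=> vV; apply/(cells_cover hV); exists j; exact: span_ge0_mem.
pose V' (x : J + unit) : seq 'rV[R]_n := if x is inl j then V j else rays R sigma.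
pose P' (x : J + unit) := if x is inl j then s j == sigma else true.
pose c' (x : J + unit) : K := if x is inl j then 1 else -1.
have := @generic_cone_relation R _ K iota ell ell_lin m <<rays R sigma>>%VS
  (@wvol R m) _ P' V' c'.
rewrite !big_sumType /= (big_pred1 tt) => [rel|[]//].
have -> : (\prod_(v <- rays R sigma) lform v)^-1 =
    iota (wvol (rays R sigma)) / \prod_(v <- rays R sigma) lform v.
  by rewrite wvol_rays rmorph1 div1r.
apply/eqP; rewrite -subr_eq0 -mulN1r; apply/eqP; move: rel.
under eq_bigr do rewrite mul1r.
rewrite (eq_big_seq lform) => [|v /ray0[/ellE->]//].
rewrite (eq_bigr (fun j => iota (wvol (V j)) / \prod_(v <- V j) lform v)); last first.
  move=> j /eqP sj; congr (_ / _); apply: eq_big_seq => v vV.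
  by rewrite ellE // -sj; exact: sV.
apply.
- by rewrite (eqnP fr) size_rays.
- exact: wvol_perm.
- exact: wvol_lin.
- case=> [j /eqP sj|[] _] /=; last by [].
  by split; [exact: (cell_free hV) | rewrite (cell_span hV (sV j)) sj].
- case=> [j v /eqP sj vV|[] v _ vr] /=.
    have cv : chamber sigma v by rewrite -sj; exact: sV.
    by rewrite -ellE // lform_neq0 ?(cell0 j) // (free_not0 (cell_free hV j)).
  by have [cv v0] := ray0 v vr; rewrite -ellE // lform_neq0 // (free_not0 fr).
apply: generic_mono (generic_fan hV K sigma sV) => p _ sum1.
rewrite big_sumType /= (big_pred1 tt) => [|[]//].
under eq_bigr do rewrite mul1r.
by rewrite sum1 mulN1r subrr.
Qed.

Lemma cells_sum :
  \sum_j iota (wvol (V j)) / \prod_(v <- V j) lform v =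
  \sum_(sigma : 'S_n) (\prod_(v <- rays R sigma) lform v)^-1.
Proof.
have [s sV] := choice (cell_chamber hV).
rewrite (partition_big s xpredT) //=; apply: eq_bigr => sigma _.
exact: chamber_cells_sum.
Qed.

(** At [ray S] the support function of [Delta T] is [c] minus 1 if [T] is contained in [S], and [c]
    otherwise; the condition on [y] cancels the contribution of [c]. *)
Lemma lform_ray (S : {set 'I_n}) : \sum_T y T = 0 ->
  lform (ray R S) = - \sum_(T : nonempty_subset n | val T \subset S) y T.
Proof.
move=> y0; set c := phi (indic R S) / #|nonempty_subset n|%:R.
transitivity (\sum_T (y T * iota c - (if val T \subset S then y T else 0))).
  apply: eq_bigr => T _; rewrite hfun_Delta.
  have -> : minT T (ray R S) = (val T \subset S)%:R - c.
    case: (boolP (val T \subset S)) => [/fintype.subsetP TS|/fintype.subsetPn[i iT iS]].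
      have [i iT ->] := minT_ex T (ray R S).
      by rewrite rayE TS.
    rewrite (@minT_eq _ _ _ _ i) // => [|k _]; rewrite !rayE (negbTE iS) //.
    by rewrite lerD2r ler0n.
  by rewrite opprB rmorphB /= mulrBr; case: ifP; rewrite ?rmorph1 ?rmorph0 ?mulr1 ?mulr0.
by rewrite sumrB -mulr_suml y0 mul0r sub0r -big_mkcond.
Qed.

End CellSums.

(** * Substitution in rational functions *)

Lemma tofrac_addf (D : idomainType) (p q r s : D) : q != 0 -> s != 0 ->
  FracField.tofrac p / FracField.tofrac q + FracField.tofrac r / FracField.tofrac s =
  FracField.tofrac (p * s + r * q) / FracField.tofrac (q * s).
Proof. by move=> q0 s0; rewrite addf_div ?tofrac_eq0 // tofracD !tofracM. Qed.

Section Substitution.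
Variables (R : realType) (I : finType) (s : I -> {mpoly R[#|I|]}).
Local Notation sub p := (p \mPo [tuple s (enum_val k) | k < #|I|]).

Lemma sub_xpoly i : sub (xpoly R i) = s i.
Proof. by rewrite /xpoly comp_mpolyXU -tnth_nth tnth_mktuple enum_rankK. Qed.

Lemma frac_subst_quot (p q : {mpoly R[#|I|]}) : sub q != 0 ->
  frac_subst s (FracField.tofrac p / FracField.tofrac q)
    (FracField.tofrac (sub p) / FracField.tofrac (sub q)).
Proof. by move=> q0; exists p, q. Qed.

(** Over the product of the denominators, which stays nonzero after substitution because polynomials
    form a domain. *)
Lemma frac_subst_sum (J : finType) (f g : J -> ratfun R I) :
  (forall j, frac_subst s (f j) (g j)) -> frac_subst s (\sum_j f j) (\sum_j g j).
Proof.
move=> fg; elim/big_rec2: _ => [|j g' f' _ [p [q [q0 -> ->]]]].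
  have := @frac_subst_quot 0 1; rewrite !rmorph0 rmorph1 !mul0r; apply; exact: oner_neq0.
have [p' [q' [q'0 -> ->]]] := fg j.
have nz (r : {mpoly R[#|I|]}) : sub r != 0 -> r != 0.
  by apply: contraNneq => ->; rewrite rmorph0.
have subM a b : sub (a * b) = sub a * sub b by exact: rmorphM.
exists (p' * q + p * q'), (q' * q); rewrite comp_mpolyD !subM; split.
- exact: mulf_neq0.
- exact: (tofrac_addf p' p (nz _ q'0) (nz _ q0)).
- exact: (tofrac_addf (sub p') (sub p) q'0 q0).
Qed.

End Substitution.

(** * Restriction to the hyperplane of sum zero *)

Section Restriction.
Variables (R : realType) (m : nat).
Local Notation n := m.+1.
Local Notation I := (nonempty_subset n).

Lemma fullset_proof : [set: 'I_n]%SET != finset.set0.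
Proof. by rewrite -card_gt0 cardsT card_ord. Qed.

Definition fullset : I := exist (fun T : {set 'I_n} => T != finset.set0) _ fullset_proof.

Lemma sum0_subst_proper (T : I) : T != fullset -> sum0_subst R T = xpoly R T.
Proof. by rewrite /sum0_subst -val_eqE => /negbTE->. Qed.

Lemma sum0_subst_full : sum0_subst R fullset = - \sum_(U | U != fullset) xpoly R U.
Proof. by rewrite /sum0_subst eqxx. Qed.

Lemma sum0_subst_sum : \sum_(T : I) sum0_subst R T = 0.
Proof.
rewrite (bigD1 fullset) //= sum0_subst_full (eq_bigr _ sum0_subst_proper).
by rewrite addNr.
Qed.

(** A nonzero [v] with [phi v = 0] is not constant, so some [v 0 i] exceeds its minimum. Giving the
    variable of the singleton of [i] the value 1 and the other free variables the value 0 makes that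
    of the full set -1, and the form becomes [minT fullset v - v 0 i]. *)
Lemma lform_sum0_neq0 (v : 'rV[R]_n) : v != 0 -> phi v = 0 ->
  \sum_(T : I) sum0_subst R T * (hfun (@Delta R n T) v)%:MP != 0.
Proof.
move=> v0 phi0; have [i vi] : exists i, v 0 i != minT fullset v.
  apply/existsP; apply: contraT; rewrite negb_exists => /forallP vc.
  have vE : v = 0 + const_mx (minT fullset v).
    by apply/rowP => i; rewrite !mxE add0r; apply/eqP; rewrite -[_ == _]negbK vc.
  move: phi0 v0; rewrite vE phi_const {1}/phi big1 => [|T _]; last first.
    by rewrite (@minT_eq _ _ _ _ (some_mem T)) ?some_memP ?mxE // => k _; rewrite !mxE.
  rewrite add0r => /eqP; rewrite mulf_eq0 [X in _ || X]gt_eqF ?nonempty_subset_gt0 // orbF.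
  by move=> /eqP->; rewrite add0r (_ : const_mx 0 = 0) ?eqxx //; apply/rowP => k; rewrite !mxE.
have Ti0 : [set i]%SET != finset.set0 by apply/set0Pn; exists i; rewrite inE.
pose Ti : I := exist (fun T : {set 'I_n} => T != finset.set0) _ Ti0.
have mTi : minT Ti v = v 0 i by apply: minT_eq => [|k]; rewrite inE // => /eqP->.
have Tif : Ti != fullset by apply: contraNneq vi => <-; rewrite mTi.
pose w (k : 'I_#|I|) : R := (enum_val k == Ti)%:R.
have wx T : (xpoly R T).@[w] = (T == Ti)%:R by rewrite /xpoly mevalXU /w enum_rankK.
apply/eqP => /(congr1 (meval w)); rewrite rmorph0 rmorph_sum /=.
rewrite (bigD1 fullset) //= (bigD1 Ti) //= big1 => [|T /andP[Tf TTi]]; last first.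
  by rewrite rmorphM /= sum0_subst_proper // wx (negbTE TTi) mul0r.
rewrite !rmorphM /= !mevalC (sum0_subst_proper Tif) wx eqxx mul1r addr0.
rewrite sum0_subst_full rmorphN rmorph_sum /= (bigD1 Ti) //= wx eqxx big1 => [|T /andP[_ TTi]].
  rewrite addr0 mulN1r !hfun_Delta mTi opprK => /eqP; rewrite subr_eq0 eq_sym.
  exact/negP.
by rewrite wx (negbTE TTi).
Qed.

End Restriction.

Theorem proposition13p2 (R : realType) (n : nat) (hn : (0 < n)%N)
    (J : finType) (V : J -> n.-1.-tuple 'rV[R]_n)
    (hV : triangulation V
            (boundary (dual_cone (cone (minkowski_sum (@Delta R n)))))) :
  frac_subst (@sum0_subst R n)
    (hdmv (@Delta R n) V)
    ((-1) ^+ n.-1 *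
     \sum_(sigma : 'S_n) \prod_(1 <= a < n)
       (\sum_(T : nonempty_subset n | val T \subset initial_image sigma a)
          xvar R T)^-1).
Proof.
case: n => [//|m] in hn V hV *; rewrite [m.+1.-1]/= in V hV *.
pose I := nonempty_subset m.+1.
pose sub (p : {mpoly R[#|I|]}) := p \mPo [tuple sum0_subst R (enum_val k) | k < #|I|].
pose iota : {rmorphism R -> ratfun R I} := (@FracField.tofrac _ \o @mpolyC #|I| R)%FUN.
(* The cells are summed at the variables already restricted to the hyperplane, as [lform_ray]
   requires. *)
pose y (T : I) : ratfun R I := FracField.tofrac (sum0_subst R T).
pose q (v : 'rV[R]_m.+1) : {mpoly R[#|I|]} := \sum_T xpoly R T * (hfun (@Delta R _ T) v)%:MP.
have subq v : sub (q v) = \sum_T sum0_subst R T * (hfun (@Delta R m.+1 T) v)%:MP.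
  rewrite /sub rmorph_sum; apply: eq_bigr => T _.
  by rewrite rmorphM /= sub_xpoly comp_mpolyC.
have lformE v : lform iota y v = FracField.tofrac (sub (q v)).
  by rewrite subq rmorph_sum; apply: eq_bigr => T _; rewrite rmorphM.
have lform0 v : v != 0 -> phi v = 0 -> lform iota y v != 0.
  by move=> v0 phi0; rewrite lformE tofrac_eq0 subq lform_sum0_neq0.
have y0 : \sum_T y T = 0 by rewrite -rmorph_sum sum0_subst_sum rmorph0.
(* The substitution can be made term by term, because the linear forms in the denominators stay
   nonzero on the hyperplane. *)
suff -> : (-1) ^+ m * \sum_(sigma : 'S_m.+1) \prod_(1 <= a < m.+1)
      (\sum_(T : I | val T \subset initial_image sigma a) xvar R T)^-1 =
    \sum_j iota (wvol (V j)) / \prod_(v <- V j) lform iota y v.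
  apply: frac_subst_sum => j; rewrite /wvol size_tuple eqxx.
  pose c := `|\det (mxseq (rcons (V j) (const_mx 1)))|.
  have subQ : FracField.tofrac (sub (\prod_(v <- V j) q v)) = \prod_(v <- V j) lform iota y v.
    by rewrite /sub !rmorph_prod; apply: eq_bigr => v _; rewrite lformE.
  have -> : \prod_(v <- V j) (\sum_T xvar R T * cst _ (hfun (@Delta R m.+1 T) v) +
      \sum_(k < m.+1) cst _ (v 0 k) * (0 : 'rV_m.+1) 0 k) =
      FracField.tofrac (\prod_(v <- V j) q v) :> ratfun R I.
    rewrite rmorph_prod; apply: eq_bigr => v _.
    rewrite [X in _ + X]big1 ?addr0 => [|k _]; last by rewrite mxE mulr0.
    by rewrite rmorph_sum; apply: eq_bigr => T _; rewrite rmorphM.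
  rewrite -subQ -[iota _]/(FracField.tofrac (c%:MP)).
  rewrite -{1}(comp_mpolyC c [tuple sum0_subst R (enum_val k) | k < #|I|]).
  apply: frac_subst_quot; rewrite -tofrac_eq0 subQ prodf_seq_neq0; apply/allP => v vV /=.
  have fV := cell_free hV j.
  apply: lform0; first exact: (free_not0 fV).
  by apply/(cells_cover hV); exists j; exact: span_ge0_mem.
rewrite (cells_sum hV lform0) mulr_sumr; apply: eq_bigr => sigma _.
have -> : \prod_(v <- rays R sigma) lform iota y v = \prod_(1 <= a < m.+1)
    - \sum_(T : I | val T \subset initial_image sigma a) xvar R T.
  rewrite big_map big_add1 /= /index_iota subn0; apply: eq_big_seq => a.
  rewrite mem_iota /= => am; rewrite lform_ray //; congr (- _).
  (* An initial image of size at most m misses [sigma ord_max], so [T] is proper and its variable is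
     unchanged. *)
  apply: eq_bigr => T /fintype.subsetP Ta; rewrite /y sum0_subst_proper //.
  apply/eqP => Tfull; have := Ta (sigma ord_max).
  by rewrite Tfull inE mem_initial_image permK /= ltnS leqNgt am => /(_ isT).
(* One sign for each of the m rays. *)
have -> : (-1) ^+ m = \prod_(1 <= a < m.+1) -1 :> ratfun R I.
  by rewrite prodr_const_nat subn1.
rewrite -prodfV -big_split /=; apply: eq_bigr => a _.
by rewrite invrN mulN1r.
Qed.
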